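(* $\textsc{BNSL}^{\neq 0}$ is fixed-parameter tractable when parameterized by the number of dependent vertices.
   Context: Let $V$ be a finite set and $\mathcal{F}=\{f_v:2^{V\setminus\{v\}}\to\mathbb{N}_0 : v\in V\}$. For a digraph $D=(V,A)$ let $P_D(v)=\{u:uv\in A\}$ and $\texttt{score}(D)=\sum_v f_v(P_D(v))$. BNSL: given $V$, $\mathcal{F}$ and an integer $\ell$, decide whether there is an acyclic digraph $D$ on $V$ with $\texttt{score}(D)\geq\ell$. In $\textsc{BNSL}^{\neq 0}$, $\mathcal{F}$ is given in the non-zero representation: for each $v$ the collection $\Gamma_f(v)=\{Z:f_v(Z)\neq0\}$ with its values; input size $|V|+\ell+\sum_{v,P\in\Gamma_f(v)}|P|$. A vertex $v$ is dependent if its set of candidate parents $P_\to(v)=\bigcup_{Z\in\Gamma_f(v)}Z$ is non-empty. *)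

(* Defs.v *)
From mathcomp Require Import all_boot all_order all_algebra.

Set Implicit Arguments.
Unset Strict Implicit.
Unset Printing Implicit Defensive.

(** * Random access machines

    Unit-cost RAM: registers hold natural numbers and are initially 0; the
    input is a read-only array of natural numbers with random access (cells
    outside the input read as 0).  Addition and truncated subtraction are the
    only arithmetic operations, so each step lengthens the largest number by
    at most one bit (beyond the constants of the program) and the model is
    polynomially equivalent to Turing machines. *)

Inductive instr : Type :=
| Const of nat & nat
| Add of nat & nat & nat
| Sub of nat & nat & nat
| Fetch of nat & nat
| Store of nat & nat
| Read of nat & nat
| Jump of nat
| Jzero of nat & nat.

Definition program := seq instr.

Record config := Config { pc : nat; reg : nat -> nat }.

Definition upd (m : nat -> nat) (i x : nat) : nat -> nat :=
  fun j => if j == i then x else m j.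

Definition exec (w : seq nat) (a : instr) (s : config) : config :=
  let: Config l m := s in
  match a with
  | Const i c => Config l.+1 (upd m i c)
  | Add i j k => Config l.+1 (upd m i (m j + m k))
  | Sub i j k => Config l.+1 (upd m i (m j - m k))
  | Fetch i j => Config l.+1 (upd m i (m (m j)))
  | Store i j => Config l.+1 (upd m (m i) (m j))
  | Read i j => Config l.+1 (upd m i (nth 0 w (m j)))
  | Jump l' => Config l' m
  | Jzero i l' => Config (if m i == 0 then l' else l.+1) m
  end.

(* The machine halts when the program counter leaves the program; halted
   configurations are fixed points of [step]. *)
Definition step (p : program) (w : seq nat) (s : config) : config :=
  if onth p (pc s) is Some a then exec w a s else s.

Definition run (p : program) (w : seq nat) (t : nat) : config :=
  iter t (step p w) (Config 0 (fun=> 0)).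

(* On input [w], [p] halts after at most [t] steps with [y] in register 0. *)
Definition outputs_within (p : program) (w : seq nat) (t y : nat) : Prop :=
  size p <= pc (run p w t) /\ reg (run p w t) 0 = y.

Definition computable (f : nat -> nat) : Prop :=
  exists p : program, forall k, exists t, outputs_within p [:: k] t (f k).

(** * Fixed-parameter tractability *)

(* [encodes x w] says that the array [w] is a presentation of the instance
   [x]; an instance may have several presentations, and an algorithm has to be
   correct and fast on all of them. *)
Record param_problem := ParamProblem {
  instance : Type;
  yes : instance -> Prop;
  param : instance -> nat;
  isize : instance -> nat;
  encodes : instance -> seq nat -> Prop }.

(* The successor of the size only matters for instances of size 0, on which
   the bound would otherwise vanish. *)
Definition fpt (Q : param_problem) : Prop :=
  exists (p : program) (f : nat -> nat) (c : nat),
    computable f /\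
    forall (x : instance Q) (w : seq nat), encodes x w ->
    exists2 b : bool, b <-> yes x &
      outputs_within p w (f (param x) * (isize x).+1 ^ c) b.

(** * Bayesian network structure learning *)

(* The vertex set is 'I_(nV I).  A function on the subsets of V \ {v} is
   represented by its extension by 0 to all subsets of V. *)
Record bnsl := Bnsl {
  nV : nat;
  score_fun : 'I_nV -> {set 'I_nV} -> nat;
  score_fun_self : forall v (Z : {set _}), v \in Z -> score_fun v Z = 0;
  target : int }.

Definition parents n (A : {set 'I_n * 'I_n}) (v : 'I_n) : {set 'I_n} :=
  [set u | (u, v) \in A].

(* No directed cycle; a loop is a directed cycle. *)
Definition acyclic n (A : {set 'I_n * 'I_n}) : Prop :=
  forall c : seq 'I_n, ucycle (fun u v => (u, v) \in A) c -> c = [::].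

Definition score (I : bnsl) (A : {set 'I_(nV I) * 'I_(nV I)}) : nat :=
  \sum_(v < nV I) score_fun v (parents A v).

Definition bnsl_yes (I : bnsl) : Prop :=
  exists2 A : {set 'I_(nV I) * 'I_(nV I)},
    acyclic A & (target I <= (score A)%:Z)%R.

Definition nonzero_sets (I : bnsl) (v : 'I_(nV I)) : {set {set 'I_(nV I)}} :=
  [set Z | score_fun v Z != 0].

Definition candidate_parents (I : bnsl) (v : 'I_(nV I)) : {set 'I_(nV I)} :=
  \bigcup_(Z in nonzero_sets v) Z.

Definition dependent (I : bnsl) (v : 'I_(nV I)) : bool :=
  candidate_parents v != set0.

Definition num_dependent (I : bnsl) : nat :=
  #|[set v : 'I_(nV I) | dependent v]|.

(* The score values are not counted: each of them occupies one cell. *)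
Definition nonzero_size (I : bnsl) : nat :=
  nV I + `|target I|%N + \sum_(v < nV I) \sum_(Z in nonzero_sets v) #|Z|.

(* [L] lists, without repetition and in any order, the sets of
   [nonzero_sets v] together with their scores, each set being itself listed
   without repetition and in any order. *)
Definition lists_nonzero (I : bnsl) (v : 'I_(nV I))
    (L : seq (seq 'I_(nV I) * nat)) : Prop :=
  all (fun e => uniq e.1) L /\
  perm_eq [seq ([set u in e.1], e.2) | e <- L]
          [seq (Z, score_fun v Z) | Z in nonzero_sets v].

Definition entry_word n (e : seq 'I_n * nat) : seq nat :=
  e.2 :: size e.1 :: [seq val u | u <- e.1].

Definition vertex_word n (L : seq (seq 'I_n * nat)) : seq nat :=
  size L :: flatten [seq entry_word e | e <- L].

(* The target is written as a sign cell followed by its absolute value. *)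
Definition nonzero_encodes (I : bnsl) (w : seq nat) : Prop :=
  exists2 G : 'I_(nV I) -> seq (seq 'I_(nV I) * nat),
    forall v, lists_nonzero v (G v) &
    w = [:: nV I; nat_of_bool (target I < 0)%R; `|target I|%N]
        ++ flatten [seq vertex_word (G v) | v <- enum 'I_(nV I)].

Definition bnsl_nonzero_by (k : bnsl -> nat) : param_problem :=
  ParamProblem bnsl_yes k nonzero_size nonzero_encodes.

(* Main.v *)
(* Independent vertices may be taken to be sources, so an acyclic digraph is
   described, up to its score, by a rank function R with R = 0 on independent
   vertices and R <= k on the k dependent ones: vertex v may use the listed
   parent set Z as soon as R u < R v for all u in Z.  There are (k+1)^k such
   functions; the machine enumerates them with a mixed-radix counter and, for
   each of them, finds the best parent set of every vertex in one linear scan of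
   the input.  The number of ancestors among the dependent vertices is a rank
   function realising a given acyclic digraph. *)

(* [Defs] is imported last so that [Sub] is the instruction, not [eqtype.Sub]. *)
From mathcomp Require Import all_boot all_order all_algebra zify.
Require Import Defs.

Set Implicit Arguments.
Unset Strict Implicit.
Unset Printing Implicit Defensive.

(** * A structured language compiled to the machine *)

Local Notation memory := (nat -> nat) (only parsing).

Inductive cmd :=
| Block of seq instr
| Seq of cmd & cmd
| If of nat & cmd & cmd
| While of nat & cmd.

Fixpoint len c :=
  match c with
  | Block s => size s
  | Seq c1 c2 => len c1 + len c2
  | If _ c1 c2 => (len c1 + len c2).+2
  | While _ c => (len c).+2
  end.

(** Jump targets are absolute, so [l] carries the address at which the code will stand. *)
Fixpoint compile l c : program :=
  match c with
  | Block s => s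
  | Seq c1 c2 => compile l c1 ++ compile (l + len c1) c2
  | If r c1 c2 =>
      Jzero r (l + len c1).+2 :: compile l.+1 c1
      ++ Jump (l + len c1 + len c2).+2 :: compile (l + len c1).+2 c2
  | While r c => Jzero r (l + len c).+2 :: rcons (compile l.+1 c) (Jump l)
  end.

Lemma size_compile l c : size (compile l c) = len c.
Proof.
elim: c l => [s|c1 IH1 c2 IH2|r c1 IH1 c2 IH2|r c IH] l //=.
- by rewrite size_cat IH1 IH2.
- by rewrite size_cat /= IH1 IH2 addnS.
- by rewrite size_rcons IH.
Qed.

Definition straight (a : instr) : bool :=
  match a with Jump _ | Jzero _ _ => false | _ => true end.

(** * A program logic for total correctness with time bounds *)

Section Logic.

Variable w : seq nat.

(** The counter value 0 is arbitrary: what an instruction does to the memory does not depend on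
    it. *)
Definition effect (m : memory) (a : instr) : memory := reg (exec w a (Config 0 m)).

(** Total correctness within [T] steps. Quantifying over the surrounding code [pre] and [post] frees
    the predicate from the place where [c] stands, which makes it compositional. *)
Definition wp (c : cmd) (T : nat) (Q : memory -> Prop) (m : memory) : Prop :=
  forall p pre post, p = pre ++ compile (size pre) c ++ post ->
  exists t m', [/\ t <= T,
    iter t (step p w) (Config (size pre) m) = Config (size pre + len c) m' & Q m'].

Lemma wp_conseq c T T' (Q Q' : memory -> Prop) m :
  wp c T Q m -> T <= T' -> (forall m', Q m' -> Q' m') -> wp c T' Q' m.
Proof.
move=> H leT QQ p pre post Ep; have [t [m' [let' E q]]] := H p pre post Ep.
by exists t, m'; split; [exact: leq_trans leT | | exact: QQ].
Qed.

Lemma wp_le c T T' Q m : T <= T' -> wp c T Q m -> wp c T' Q m.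
Proof. by move=> leT H; apply: wp_conseq H leT _. Qed.

Lemma wp_skip T (Q : memory -> Prop) m : Q m -> wp (Block [::]) T Q m.
Proof. by move=> q p pre post _; exists 0, m; split; rewrite ?addn0. Qed.

Lemma step_at p pre a post m : p = pre ++ a :: post ->
  step p w (Config (size pre) m) = exec w a (Config (size pre) m).
Proof.
move=> ->; rewrite /step /=.
by rewrite -[onth _ _]/(onth (pre ++ a :: post) (size pre)) onth_cat ltnn subnn.
Qed.

Lemma wp_block s (Q : memory -> Prop) m :
  all straight s -> Q (foldl effect m s) -> wp (Block s) (size s) Q m.
Proof.
move=> + + p pre post /=; elim: s m pre => [|a s IH] m pre /=.
  by move=> _ q _; exists 0, m; split; rewrite ?addn0.
move=> /andP[sa ss] q Ep.
have Ep' : p = rcons pre a ++ s ++ post by rewrite cat_rcons.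
have [t [m' [let' E q']]] := IH _ _ ss q Ep'.
exists t.+1, m'; split => //.
rewrite iterSr (step_at _ Ep) addnS -addSn.
by rewrite size_rcons in E; rewrite -E; case: a sa {q Ep Ep' E IH}.
Qed.

Lemma wp_seq c1 c2 T1 T2 Q m :
  wp c1 T1 (wp c2 T2 Q) m -> wp (Seq c1 c2) (T1 + T2) Q m.
Proof.
move=> H p pre post /=; rewrite -catA => Ep.
have [t1 [m1 [le1 E1 /(_ p (pre ++ compile (size pre) c1) post)]]] := H p _ _ Ep.
rewrite size_cat size_compile -catA => /(_ Ep) [t2 [m2 [le2 E2 q]]].
exists (t2 + t1), m2; split => //; first by rewrite addnC leq_add.
by rewrite iterD E1 E2 addnA.
Qed.

(** The two extra steps are the test and, after the first branch, the jump over the second. *)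
Lemma wp_if r c1 c2 T Q m :
  wp (if m r != 0 then c1 else c2) T Q m -> wp (If r c1 c2) T.+2 Q m.
Proof.
move=> H p pre post /= Ep; have := step_at m Ep; rewrite /exec.
case: eqP H => /= [_|_] H E0.
- have [] := H p (rcons (rcons pre (Jzero r (size pre + len c1).+2)
                    ++ compile (size pre).+1 c1)
                  (Jump (size pre + len c1 + len c2).+2)) post.
    rewrite size_rcons size_cat size_rcons size_compile cat_rcons -catA cat_rcons.
    by rewrite Ep /= -catA /= addSn.
  rewrite size_rcons size_cat size_rcons size_compile => t [m' [let' E q]].
  exists t.+1, m'; split => //; first lia.
  by rewrite iterSr E0 -addSn E; congr Config; lia.
- have [] := H p (rcons pre (Jzero r (size pre + len c1).+2))
     (Jump (size pre + len c1 + len c2).+2 :: compile (size pre + len c1).+2 c2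
      ++ post).
    by rewrite size_rcons cat_rcons Ep /= -catA.
  rewrite size_rcons => t [m' [let' E q]].
  exists t.+2, m'; split => //.
  rewrite iterS iterSr E0 E.
  have := @step_at p (rcons pre (Jzero r (size pre + len c1).+2)
                    ++ compile (size pre).+1 c1) (Jump (size pre + len c1 + len c2).+2)
                 (compile (size pre + len c1).+2 c2 ++ post) m'.
  rewrite size_cat size_rcons size_compile => -> /=.
    by congr Config; lia.
  by rewrite cat_rcons Ep /= -!catA.
Qed.

(** Termination comes from the list [s] of items still to be processed. Each round pays two extra
    steps, for the test and the jump back; the test that leaves the loop pays one. *)
Lemma wp_while A (cost : A -> nat) (Inv : seq A -> memory -> Prop) r c
    (Q : memory -> Prop) s m :
  (forall m, Inv [::] m -> m r = 0 /\ Q m) ->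
  (forall a s m, Inv (a :: s) m -> m r <> 0 /\ wp c (cost a) (Inv s) m) ->
  Inv s m -> wp (While r c) (\sum_(a <- s) (cost a).+2).+1 Q m.
Proof.
move=> Hnil Hcons HI p pre post /= Ep.
elim: s m HI => [|a s IH] m HI.
  have [m0 q] := Hnil _ HI.
  exists 1, m; split => //; rewrite /= (step_at _ Ep) /= m0 eqxx.
  by congr Config; lia.
have [mr H] := Hcons _ _ _ HI.
have [] := H p (rcons pre (Jzero r (size pre + len c).+2)) (Jump (size pre) :: post).
  by rewrite size_rcons cat_rcons Ep /= cat_rcons.
rewrite size_rcons => t1 [m1 [le1 E1 HI1]].
have [t2 [m2 [le2 E2 q]]] := IH _ HI1.
exists (t2 + t1.+2), m2; split => //; first by rewrite big_cons; lia.
rewrite iterD iterS iterSr (step_at _ Ep) /=; move/eqP/negPf: mr => ->; rewrite E1.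
have := @step_at p (rcons pre (Jzero r (size pre + len c).+2)
                    ++ compile (size pre).+1 c) (Jump (size pre)) post m1.
rewrite size_cat size_rcons size_compile => -> //=.
by rewrite cat_rcons Ep /= -!catA cat_rcons.
Qed.

(** The counting case of the loop rule: the items still pending are the numbers from [i] to
    [N - 1]. *)
Lemma wp_for (cost : nat -> nat) (Inv : nat -> memory -> Prop) r c
    (Q : memory -> Prop) N m :
  (forall m, Inv N m -> m r = 0 /\ Q m) ->
  (forall i m, i < N -> Inv i m -> m r <> 0 /\ wp c (cost i) (Inv i.+1) m) ->
  Inv 0 m -> wp (While r c) (\sum_(i < N) (cost i).+2).+1 Q m.
Proof.
move=> HN HS H0; rewrite -(big_mkord xpredT (fun i => (cost i).+2)) /index_iota subn0.
pose J s m := exists2 i, i <= N & s = iota i (N - i) /\ Inv i m.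
apply: (wp_while (Inv := J)); last by exists 0; rewrite // subn0.
- move=> m' [i leiN [E HI]]; apply: HN.
  suff -> : N = i by [].
  by move: E; case: (N - i) (subnK leiN) => // ->.
- move=> a s m' [i leiN []]; case E: (N - i) => [//|d] /= [-> ->] HI.
  have ltiN : i < N by lia.
  have [? H] := HS _ _ ltiN HI; split => //.
  apply: wp_conseq H _ _ => // m'' HI'; exists i.+1 => //; split=> //.
  by congr iota; lia.
Qed.

(** A halted configuration is a fixed point of [step], so a run that ends early shows the same state
    at time [T]. *)
Lemma wp_outputs c T (Q : nat -> Prop) :
  wp c T (fun m => Q (m 0)) (fun=> 0) ->
  exists2 y, Q y & outputs_within (compile 0 c) w T y.
Proof.
move=> /(_ (compile 0 c) [::] [::]); rewrite cats0 => /(_ erefl) [t [m [let' E q]]].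
exists (m 0) => //.
have Er : run (compile 0 c) w T = Config (len c) m.
  rewrite /run -(subnK let') iterD E /=.
  elim: (T - t) => //= d ->.
  by rewrite /step /= onth_default // size_compile.
by rewrite /outputs_within Er size_compile.
Qed.

End Logic.

(** * The program *)

(* Register [rone] holds 1 and [rbase] holds 20.  Cell 20 + 2u holds the rank of
   vertex u, and cell 21 + 2u the sum of the sizes of its listed parent sets,
   which is nonzero exactly when u is dependent. *)
Local Notation rans := 0 (only parsing).
Local Notation rone := 1 (only parsing).
Local Notation rn := 2 (only parsing).
Local Notation rT := 3 (only parsing).
Local Notation rgo := 4 (only parsing).
Local Notation rpos := 5 (only parsing).
Local Notation rv := 6 (only parsing).
Local Notation rcv := 7 (only parsing).
Local Notation rcnt := 8 (only parsing).
Local Notation rval := 9 (only parsing).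
Local Notation rs := 10 (only parsing).
Local Notation ra := 11 (only parsing).
Local Notation rbad := 12 (only parsing).
Local Notation rbest := 13 (only parsing).
Local Notation rrank := 14 (only parsing).
Local Notation rtot := 15 (only parsing).
Local Notation rk := 16 (only parsing).
Local Notation rx := 17 (only parsing).
Local Notation rdep := 18 (only parsing).
Local Notation rbase := 19 (only parsing).

(** [rbad] accumulates the truncated differences [R u + 1 - rrank] over the members [u]. Started at
    0, it stays 0 exactly when every member has rank below [rrank]. *)
Definition members_loop : cmd :=
  While rs (Block
    [:: Read rx rpos; Add ra rbase rx; Add ra ra rx; Fetch rx ra;
        Add rx rx rone; Sub rx rx rrank; Add rbad rbad rx;
        Add rpos rpos rone; Sub rs rs rone]).

(** With truncated subtraction, [rbest + (rval - rbest)] is the maximum of both, so each admissible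
    set updates a running maximum. *)
Definition entries_loop : cmd :=
  While rcnt (Seq (Block
    [:: Read rval rpos; Add rpos rpos rone; Read rs rpos; Add rpos rpos rone;
        Const rbad 0])
  (Seq members_loop
  (Seq (If rbad (Block [::]) (Block [:: Sub rval rval rbest; Add rbest rbest rval]))
       (Block [:: Sub rcnt rcnt rone])))).

(** Position 3 skips the header: vertex count, sign and absolute value of the target. *)
Definition scan : cmd :=
  Seq (Block [:: Const rpos 3; Const rv 0; Const rcv 0; Add rcv rcv rn; Const rtot 0])
  (While rcv (Seq (Block
    [:: Read rcnt rpos; Add rpos rpos rone; Const rbest 0;
        Add ra rbase rv; Add ra ra rv; Fetch rrank ra])
  (Seq entries_loop
       (Block [:: Add rtot rtot rbest; Add rv rv rone; Sub rcv rcv rone])))).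

(** Adds one to a mixed-radix counter whose lowest digit is the rank of vertex 0. [rgo] is 0 while
    the carry is pending and 1 once a digit has absorbed it; a carry out of the last digit leaves it
    at 0, which ends the enumeration. *)
Definition odometer : cmd :=
  Seq (Block [:: Const rgo 0; Const rv 0; Const rcv 0; Add rcv rcv rn])
  (While rcv (Seq
    (If rgo (Block [::])
      (Seq (Block [:: Add ra rbase rv; Add ra ra rv; Fetch rval ra;
                      Add rx ra rone; Fetch rx rx])
      (Seq (If rx (Block [:: Const rx 0; Add rx rx rk; Sub rx rx rval]) (Block [::]))
      (Seq (If rx (Block [:: Add rval rval rone; Const rgo 1])
                  (Block [:: Const rval 0]))
           (Block [:: Store ra rval])))))
    (Block [:: Add rv rv rone; Sub rcv rcv rone]))).

Definition count_loop : cmd :=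
  While rcnt (Block
    [:: Add rpos rpos rone; Read rs rpos; Add rpos rpos rone; Add rdep rdep rs;
        Add rpos rpos rs; Sub rcnt rcnt rone]).

(** Relies on registers being 0 at the start: [rans] serves as the address of cell 0, and [rT] keeps
    the value 0 when the target is negative. *)
Definition setup : cmd :=
  Seq (Block [:: Const rone 1; Const rbase 20; Read rn rans; Read rx rone])
  (Seq (If rx (Block [::]) (Block [:: Const rT 2; Read rT rT]))
  (Seq (Block [:: Const rpos 3; Add rcv rcv rn])
  (While rcv (Seq (Block [:: Read rcnt rpos; Add rpos rpos rone; Const rdep 0])
  (Seq count_loop
  (Seq (If rdep (Block [:: Add rk rk rone]) (Block [::]))
       (Block [:: Add ra rbase rv; Add ra ra rv; Add ra ra rone; Store ra rdep;
                  Add rv rv rone; Sub rcv rcv rone]))))))).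

(** [rT - rtot] vanishes exactly when the threshold is reached; [rans] then stays 1 for the rest of
    the enumeration. *)
Definition bnsl_prog : cmd :=
  Seq setup (Seq (Block [:: Const rgo 1])
  (While rgo (Seq scan
    (Seq (Block [:: Sub rx rT rtot])
    (Seq (If rx (Block [::]) (Block [:: Const rans 1])) odometer))))).

(** * Verification of the scan for a fixed rank function *)

Definition same (l : seq nat) (m m' : memory) : Prop :=
  forall j, j \notin l -> m' j = m j.

Lemma same_refl l m : same l m m.
Proof. by []. Qed.

Lemma drop_cons (w : seq nat) i x s :
  drop i w = x :: s -> nth 0 w i = x /\ drop (i + 1) w = s.
Proof.
move=> E; rewrite -[i in nth _ _ i]addn0 -nth_drop addnC -drop_drop.
by rewrite E /= drop0.
Qed.

Ltac frame H :=
  let j := fresh "j" in let Hj := fresh "Hj" in let Ej := fresh "Ej" in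
  move=> j Hj; rewrite /=;
  do ?[case: eqP => [Ej|_]; first by rewrite Ej in Hj]; by apply: H.

Lemma cell_neq u i : i < 20 -> (20 + u + u == i) = false.
Proof. lia. Qed.

Lemma sum_const_seq A (s : seq A) n : \sum_(a <- s) n = n * size s.
Proof. by rewrite big_const_seq count_predT iter_addn_0. Qed.

Section Scan.

Variables (w : seq nat) (R : nat -> nat).

Lemma members_spec us rest m :
  m rone = 1 -> m rbase = 20 -> (forall u, m (20 + u + u) = R u) ->
  drop (m rpos) w = us ++ rest -> m rs = size us ->
  wp w members_loop (11 * size us).+1 (fun m' =>
    [/\ same [:: rs; rx; ra; rbad; rpos] m m', drop (m' rpos) w = rest &
        (m' rbad == 0) = (m rbad == 0) && all (fun u => R u < m rrank) us]) m.
Proof.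
move=> m1 m19 mR Hd Hs.
pose ok := all (fun u => R u < m rrank).
pose Inv l m' := [/\ same [:: rs; rx; ra; rbad; rpos] m m', m' rs = size l,
   drop (m' rpos) w = l ++ rest & (m' rbad == 0) && ok l = (m rbad == 0) && ok us].
rewrite -sum_const_seq.
apply: (@wp_while w nat (fun=> 9) Inv).
- by move=> m' [H1 H2 H3 H4]; split=> //; split=> //; rewrite -H4 andbT.
- move=> u l m' [H1 H2 /drop_cons [H3 H3'] H4]; split; first by rewrite H2.
  apply: wp_block => //; rewrite /effect /= /upd /=.
  rewrite !H3 !(H1 19) // !(H1 14) // !(H1 1) // m19 m1 H2.
  rewrite !cell_neq // (H1 (20 + u + u)) // mR.
  split => //=.
  + frame H1.
  + lia.
  + by rewrite -H4 /ok /= addn_eq0 andbA; congr (_ && _ && _); lia.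
- by split.
Qed.

(** The layout of [entry_word] with plain numbers as vertices, which is what the machine sees. *)
Definition entry_cells (e : seq nat * nat) : seq nat := e.2 :: size e.1 :: e.1.

(** When no listed set is admissible the value is 0, which every parent set reaches. *)
Definition best (r : nat) (L : seq (seq nat * nat)) : nat :=
  \max_(e <- L | all (fun u => R u < r) e.1) e.2.

Definition scan_regs := [:: rcnt; rval; rbest; rs; rx; ra; rbad; rpos].

Lemma entries_spec L rest m :
  m rone = 1 -> m rbase = 20 -> (forall u, m (20 + u + u) = R u) ->
  drop (m rpos) w = flatten (map entry_cells L) ++ rest -> m rcnt = size L ->
  wp w entries_loop (13 * size (flatten (map entry_cells L))).+1 (fun m' =>
    [/\ same scan_regs m m', drop (m' rpos) w = rest &
        m' rbest = maxn (m rbest) (best (m rrank) L)]) m.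
Proof.
move=> m1 m19 mR Hd Hs.
pose Inv l m' := [/\ same scan_regs m m', m' rcnt = size l,
   drop (m' rpos) w = flatten (map entry_cells l) ++ rest &
   maxn (m' rbest) (best (m rrank) l) = maxn (m rbest) (best (m rrank) L)].
(* Time is charged to the input at 13 steps per cell; an entry fills two cells besides its
   members. *)
have -> : 13 * size (flatten (map entry_cells L)) =
          \sum_(e <- L) (13 * size e.1 + 24).+2.
  elim: (L) => [|e l IH]; first by rewrite big_nil.
  by rewrite /= big_cons size_cat -IH; lia.
apply: (@wp_while w _ (fun e => 13 * size e.1 + 24) Inv).
- by move=> m' [H1 H2 H3 H4]; split=> //; split=> //; rewrite -H4 /best big_nil maxn0.
- move=> e l m' [H1 H2 H3 H4]; split; first by rewrite H2.
  move: H3 => /=/drop_cons[H3 /drop_cons[H5]]; rewrite -catA => H6.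
  apply: (@wp_le w _ (5 + ((11 * size e.1).+1 + (4 + 1)))); first lia.
  apply/wp_seq/wp_block => //; apply: wp_seq.
  rewrite /effect /= /upd /= !(H1 1) // m1 H3 H5.
  apply: wp_conseq (members_spec _ _ _ H6 _) (leqnn _) _ => //=.
  + by rewrite H1.
  + by rewrite H1.
  + by move=> u; rewrite -[RHS]mR -H1.
  move=> m2 [E1 E2 E3].
  have E4 : same scan_regs m m2.
    move=> j Hj; rewrite E1; last by apply: contra Hj; rewrite !inE; lia.
    by move: j Hj; frame H1.
  apply/wp_seq/wp_if; move: E3; rewrite /= H1 // => ->.
  have E5 : m2 rval = e.2 by rewrite E1.
  have E6 : m2 rbest = m' rbest by rewrite E1.
  have E7 : m2 rcnt = (size l).+1 by rewrite E1 //= H2.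
  have E8 : m2 rone = 1 by rewrite E4.
  rewrite /best big_cons in H4.
  case: ifP H4 => /= Hok H4.
    apply: (@wp_block _ [:: _; _]) => //; rewrite /effect /=.
    apply: wp_block => //; rewrite /effect /= /upd /=.
    rewrite E5 E6 E7 E8; split => //=.
    * by frame E4.
    * lia.
    * rewrite -H4 /best; lia.
  apply: wp_skip; apply: wp_block => //; rewrite /effect /= /upd /=.
  rewrite E7 E8; split => //=.
  * by frame E4.
  * lia.
  * by rewrite E6.
- by split.
Qed.

Definition vertex_cells (L : seq (seq nat * nat)) : seq nat :=
  size L :: flatten (map entry_cells L).

Definition total (Ls : seq (seq (seq nat * nat))) : nat :=
  \sum_(v < size Ls) best (R v) (nth [::] Ls v).

Lemma size_vertex_cells Ls : size (flatten (map vertex_cells Ls)) =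
  \sum_(i < size Ls) (size (flatten (map entry_cells (nth [::] Ls i)))).+1.
Proof.
rewrite -[in RHS](big_mkord xpredT
  (fun i => (size (flatten (map entry_cells (nth [::] Ls i)))).+1)).
rewrite -(big_nth _ xpredT (fun L => (size (flatten (map entry_cells L))).+1)).
elim: Ls => [|L Ls IH] /=; first by rewrite big_nil.
by rewrite big_cons size_cat IH; lia.
Qed.

Lemma scan_spec Ls m :
  m rone = 1 -> m rbase = 20 -> (forall u, m (20 + u + u) = R u) ->
  m rn = size Ls -> 2 < size w ->
  drop 3 w = flatten (map vertex_cells Ls) ->
  wp w scan (13 * size w) (fun m' =>
    same [:: rv, rcv, rrank, rtot & scan_regs] m m' /\ m' rtot = total Ls) m.
Proof.
move=> m1 m19 mR mn w2 Hw.
pose Inv i m' := [/\ same [:: rv, rcv, rrank, rtot & scan_regs] m m',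
   m' rv = i /\ m' rcv = size Ls - i,
   drop (m' rpos) w = flatten (map vertex_cells (drop i Ls)) &
   m' rtot = \sum_(v < i) best (R v) (nth [::] Ls v)].
apply: (@wp_le w _ (5 + (\sum_(i < size Ls)
         (13 * size (flatten (map entry_cells (nth [::] Ls i))) + 10).+2).+1)).
  (* The three header cells pay for the initialisation. *)
  have -> : size w = 3 + size (flatten (map vertex_cells Ls)).
    by rewrite -Hw size_drop; lia.
  have : \sum_(i < size Ls) (13 * size (flatten (map entry_cells (nth [::] Ls i)))
             + 10).+2 <= 13 * size (flatten (map vertex_cells Ls)).
    rewrite size_vertex_cells big_distrr /=; apply: leq_sum => i _; lia.
  lia.
apply/wp_seq/wp_block => //; rewrite /effect /= /upd /=.
apply: (@wp_for w
  (fun i => 13 * size (flatten (map entry_cells (nth [::] Ls i))) + 10) Inv).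
- by move=> m' [H1 [H2 H3] H4 H5]; split=> //; rewrite H3 subnn.
- move=> i m' lti [H1 [H2 H2'] H3 H4]; split; first by rewrite H2'; lia.
  move: H3; rewrite (drop_nth [::] lti); set L := nth _ _ i.
  move=> /= /drop_cons[H3 H5].
  apply: (@wp_le w _ (6 + ((13 * size (flatten (map entry_cells L))).+1 + 3))); first lia.
  apply/wp_seq/wp_block => //; apply: wp_seq.
  rewrite /effect /= /upd /= !(H1 1) // !(H1 19) // m1 m19 H2 H3.
  rewrite !cell_neq // (H1 (20 + i + i)) // mR.
  apply: wp_conseq (entries_spec _ _ _ H5 _) (leqnn _) _ => //=.
  + by rewrite H1.
  + by rewrite H1.
  + by move=> u; rewrite -[RHS]mR -H1.
  move=> m2 [E1 E2 E3].
  have E4 : same [:: rv, rcv, rrank, rtot & scan_regs] m m2.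
    move=> j Hj; rewrite E1; last by apply: contra Hj; rewrite !inE; lia.
    by move: j Hj; frame H1.
  apply: wp_block => //; rewrite /effect /= /upd /=.
  rewrite E3 (E1 15) // (E1 6) // (E1 7) // (E1 1) //= (H1 1) //.
  rewrite m1 H2 H2' H4 max0n; split => //=.
  + by frame E4.
  + lia.
  + by rewrite big_ord_recr.
- split => //=.
  + by frame (@same_refl [:: rv, rcv, rrank, rtot & scan_regs] m).
  + by rewrite subn0 mn.
  + by rewrite drop0.
  + by rewrite big_ord0.
Qed.
End Scan.

(** The odometer and the setup also write to cells from 20 on, so the frame condition is restricted
    to the registers below. *)
Definition same_low (l : seq nat) (m m' : memory) : Prop :=
  forall j, j < 20 -> j \notin l -> m' j = m j.

Lemma eq_rank_cell u v : (20 + u + u == 20 + v + v) = (u == v).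
Proof. lia. Qed.

Lemma eq_dep_cell u v : (20 + u + u + 1 == 20 + v + v + 1) = (u == v).
Proof. lia. Qed.

Lemma dep_rank_cell u v : (20 + u + u + 1 == 20 + v + v) = false.
Proof. lia. Qed.

Lemma rank_dep_cell u v : (20 + u + u == 20 + v + v + 1) = false.
Proof. lia. Qed.

Lemma dep_neq u i : i < 20 -> (20 + u + u + 1 == i) = false.
Proof. lia. Qed.

(** * Enumeration of the rank functions *)

Section Odometer.

Variables (w : seq nat) (n k : nat) (D : nat -> nat).

Definition bound (u : nat) : nat := if D u != 0 then k else 0.

(** The place value of digit [i] in the mixed-radix system whose digit [j] runs from 0 to [bound j];
    also the number of ways to choose the digits below [i]. *)
Definition weight (i : nat) : nat := \prod_(j < i) (bound j).+1.

(** The number written by the [i] lowest digits. *)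
Definition code (R : nat -> nat) (i : nat) : nat := \sum_(j < i) R j * weight j.

Lemma codeS R i : code R i.+1 = code R i + R i * weight i.
Proof. by rewrite /code big_ord_recr. Qed.

Lemma weightS i : weight i.+1 = weight i * (bound i).+1.
Proof. by rewrite /weight big_ord_recr. Qed.

Lemma eq_code R R' i : (forall j, j < i -> R j = R' j) -> code R i = code R' i.
Proof. by move=> E; apply: eq_bigr => j _; rewrite E. Qed.

Lemma code_lt R i : (forall u, R u <= bound u) -> code R i < weight i.
Proof.
move=> Rb; elim: i => [|i IH]; first by rewrite /code /weight !big_ord0.
by rewrite codeS weightS; have := Rb i; nia.
Qed.

(** The top digit is the quotient by its place value, because the lower digits together amount to
    less than one unit of it. *)
Lemma code_inj R R' i :
  (forall u, R u <= bound u) -> (forall u, R' u <= bound u) ->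
  code R i = code R' i -> forall j, j < i -> R j = R' j.
Proof.
move=> Rb Rb'; elim: i => // i IH; rewrite !codeS => E.
have lt1 := code_lt i Rb; have lt2 := code_lt i Rb'.
have Ei : R i = R' i.
  have Wp : 0 < weight i by lia.
  have := congr1 (fun x => x %/ weight i) E.
  by rewrite /= ![code _ _ + _]addnC !divnMDl // !divn_small // !addn0.
move=> j; rewrite ltnS leq_eqVlt => /orP[/eqP->//|]; apply: IH.
by move: E; rewrite Ei => /addIn.
Qed.

Definition odometer_regs := [:: rgo; rv; rcv; ra; rval; rx].

(** A carry pending before digit [i] is worth [weight i], so at every stage the low digits together
    with the carry are worth their old value plus one. At [i = n] this is the stated equation. *)
Lemma odometer_spec R m :
  m rone = 1 -> m rbase = 20 -> m rn = n -> m rk = k ->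
  (forall u, m (20 + u + u) = R u) -> (forall u, m (20 + u + u + 1) = D u) ->
  (forall u, R u <= bound u) ->
  wp w odometer (21 * n + 5) (fun m' => exists R',
    [/\ forall u, R' u <= bound u, forall u, m' (20 + u + u) = R' u,
        forall u, m' (20 + u + u + 1) = D u, same_low odometer_regs m m' &
        m' rgo <= 1 /\ code R' n + (m' rgo == 0) * weight n = (code R n).+1]) m.
Proof.
move=> m1 m19 mn mk mR mD Rb.
pose Inv i m' := exists R',
    [/\ (forall u, R' u <= bound u) /\ (forall u, i <= u -> R' u = R u),
        forall u, m' (20 + u + u) = R' u,
        forall u, m' (20 + u + u + 1) = D u, same_low odometer_regs m m' &
        [/\ m' rv = i, m' rcv = n - i, m' rgo <= 1 &
            code R' i + (m' rgo == 0) * weight i = (code R i).+1]].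
apply: (@wp_le w _ (4 + (\sum_(i < n) 19.+2).+1)).
  by rewrite sum_nat_const card_ord; lia.
apply/wp_seq/wp_block => //; rewrite /effect /= /upd /=.
apply: (@wp_for w (fun=> 19) Inv).
- move=> m' [R' [[H1 _] H2 H3 H4 [H5 H6 H7 H8]]]; split; first by rewrite H6 subnn.
  by exists R'; split.
- move=> i m' ltin [R' [[H1 H1'] H2 H3 H4 [H5 H6 H7 H8]]].
  have E1 : m' rone = 1 by rewrite H4.
  split; first by rewrite H6; lia.
  apply: (@wp_le w _ (17 + 2)) => //.
  apply/wp_seq/wp_if; case: eqP => /= Hgo.
    pose Q1 m2 := [/\ same_low [:: ra; rval; rx] m' m2, m2 ra = 20 + i + i,
       m2 rval = R i, m2 rx = D i & (forall u, m2 (20 + u + u) = R' u) /\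
       (forall u, m2 (20 + u + u + 1) = D u)].
    apply: (@wp_le w _ (5 + (5 + (4 + 1)))) => //.
    apply: wp_seq; apply: (@wp_conseq w _ 5 _ Q1) => //.
      apply: wp_block => //; rewrite /effect /= /upd /=.
      rewrite !(H4 19) // m19 !H5 !cell_neq // (H4 1) // m1 !dep_neq // H3 H2 H1' //.
      split => //=; first by move=> j _; move: j;
        frame (@same_refl [:: ra; rval; rx] m').
    move=> m2 [A1 A2 A3 A4 [A5 A6]].
    (* [rx] becomes the room left at digit [i]. At an independent vertex it already holds [D i = 0],
       which is that room. *)
    pose Q2 m3 := [/\ same_low [:: rx] m2 m3, m3 rx = bound i - R i,
       forall u, m3 (20 + u + u) = R' u & forall u, m3 (20 + u + u + 1) = D u].
    apply: wp_seq; apply: (@wp_conseq w _ 5 _ Q2) => //.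
      apply: wp_if; rewrite A4; case: ifP => HD.
        have Eb : bound i = k by rewrite /bound HD.
        apply: (@wp_block _ [:: _; _; _]) => //; rewrite /effect /= /upd /=.
        rewrite A3 A1 // H4 // mk; split => //=.
        + by move=> j _; move: j; frame (@same_refl [:: rx] m2).
        + by rewrite Eb; lia.
      apply: wp_skip; split => //; rewrite A4 /bound HD.
      by apply/eqP; move/negbFE/eqP: HD => ->.
    move=> m3 [B1 B2 B3 B4].
    (* The new digit: it absorbs the carry if there is room, and otherwise wraps to 0 and passes the
       carry on. *)
    pose d := if R i < bound i then (R i).+1 else 0.
    pose Q3 m4 := [/\ same_low odometer_regs m m4, m4 rv = i /\ m4 rcv = n - i,
       m4 ra = 20 + i + i /\ m4 rval = d, m4 rgo = (R i < bound i) &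
       (forall u, m4 (20 + u + u) = R' u) /\ (forall u, m4 (20 + u + u + 1) = D u)].
    have B5 : same_low odometer_regs m m3.
      move=> j lj Hj; rewrite B1 //; last by apply: contra Hj; rewrite !inE; lia.
      rewrite A1 //; last by apply: contra Hj; rewrite !inE; lia.
      exact: H4.
    have B6 : m3 rone = 1 by rewrite B5.
    have B7 : m3 rval = R i by rewrite B1 // A3.
    have B8 : m3 ra = 20 + i + i by rewrite B1 // A2.
    have B9 : m3 rv = i by rewrite B1 // A1 // H5.
    have B10 : m3 rcv = n - i by rewrite B1 // A1 // H6.
    have B11 : m3 rgo = 0 by rewrite B1 // A1 // Hgo.
    apply: wp_seq; apply: (@wp_conseq w _ 4 _ Q3) => //.
      apply: wp_if; rewrite B2 subn_eq0 -ltnNge /Q3 /d; case: ifP => Hlt.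
        apply: (@wp_block _ [:: _; _]) => //; rewrite /effect /= /upd /=.
        rewrite B6 B7; split => //=.
        + by move=> j lj Hj; rewrite !ifN ?(B5 _ lj) //;
            move: Hj; rewrite !inE; lia.
        + lia.
      apply: (@wp_le w _ 1) => //; apply: (@wp_block _ [:: _]) => //.
      rewrite /effect /= /upd /=; split => //=.
      + by move=> j lj Hj; rewrite !ifN ?(B5 _ lj) //; move: Hj; rewrite !inE; lia.
    move=> m4 [C1 [C2 C3] [C4 C5] C6 [C7 C8]].
    apply: (@wp_block _ [:: _]) => //; apply: (@wp_block _ [:: _; _]) => //.
    rewrite /effect /= /upd /= C4 C5.
    have C9 : m4 rone = 1 by rewrite C1.
    exists (upd R' i d); rewrite /upd; split => //=.
    + split=> [u|u ltiu]; last by rewrite ifN ?H1' //; lia.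
      by case: eqP => [->|//]; rewrite /d; case: ifP => //; lia.
    + by move=> u; rewrite eq_rank_cell C7.
    + by move=> u; rewrite dep_rank_cell.
    + move=> j lj Hj; rewrite !ifN ?(C1 _ lj) //; by move: Hj; rewrite !inE; lia.
    + rewrite C2 C3 C6 C9; split; try lia.
      rewrite codeS (@eq_code _ R'); last by move=> j ltj; rewrite ifN //; lia.
      rewrite eqxx !codeS weightS.
      move: H8; rewrite Hgo eqxx mul1n /d; have := Rb i.
      by case: ltnP => /= ? ?; nia.
  apply: wp_skip; apply: (@wp_block _ [:: _; _]) => //; rewrite /effect /= /upd /=.
  rewrite H5 H6 E1; exists R'; split => //=.
  + by split=> // u ltiu; apply: H1'; lia.
  + by move=> j lj Hj; rewrite !ifN ?(H4 _ lj) //; move: Hj; rewrite !inE; lia.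
  + split; try lia.
    by rewrite !codeS H1' //; move/eqP/negPf: Hgo H8 => -> ; lia.
- exists R; split => //=.
  + by move=> j lj Hj; rewrite !ifN //; move: Hj; rewrite !inE; lia.
  + by split; rewrite ?subn0 // /code /weight !big_ord0.
Qed.

End Odometer.

Definition num_members (L : seq (seq nat * nat)) : nat := \sum_(e <- L) size e.1.

(** * Correctness and running time *)

Section Setup.

Variables (w : seq nat).

Lemma count_spec L rest m :
  m rone = 1 -> m rcnt = size L ->
  drop (m rpos) w = flatten (map entry_cells L) ++ rest ->
  wp w count_loop (8 * size L).+1 (fun m' =>
    [/\ same [:: rcnt; rpos; rs; rdep] m m', drop (m' rpos) w = rest &
        m' rdep = m rdep + num_members L]) m.
Proof.
move=> m1 Hs Hd.
pose Inv l m' := [/\ same [:: rcnt; rpos; rs; rdep] m m', m' rcnt = size l,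
   drop (m' rpos) w = flatten (map entry_cells l) ++ rest &
   m' rdep + num_members l = m rdep + num_members L].
rewrite -sum_const_seq.
apply: (@wp_while w _ (fun=> 6) Inv).
- move=> m' [H1 H2 H3 H4]; split=> //; split=> //.
  by rewrite -H4 /num_members big_nil addn0.
- move=> e l m' [H1 H2 H3 H4]; split; first by rewrite H2.
  move: H3 => /=/drop_cons[_ /drop_cons[H5]]; rewrite -catA => H6.
  apply: wp_block => //; rewrite /effect /= /upd /=.
  rewrite !(H1 1) // m1 H5 H2; split => //=.
  + by frame H1.
  + lia.
  + by rewrite addnC -drop_drop H6 drop_size_cat.
  + by rewrite -H4 /num_members big_cons addnA.
- by split.
Qed.

Variables (Ls : seq (seq (seq nat * nat))) (sg t : nat).
Hypothesis def_w : w = [:: size Ls, sg, t & flatten (map vertex_cells Ls)].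

Definition deps (u : nat) : nat := num_members (nth [::] Ls u).

Definition ndeps : nat := \sum_(u < size Ls) (deps u != 0).

(** Scores are natural numbers, so a negative target may be replaced by 0. *)
Definition threshold : nat := if sg != 0 then 0 else t.

Lemma setup_spec :
  wp w setup (20 * size w) (fun m =>
    [/\ [/\ m rans = 0, m rone = 1 & m rbase = 20],
        [/\ m rn = size Ls, m rT = threshold & m rk = ndeps],
        forall u, m (20 + u + u) = 0 & forall u, m (20 + u + u + 1) = deps u])
    (fun=> 0).
Proof.
apply: (@wp_le w _ (4 + (4 + (2 + (\sum_(i < size Ls)
    (8 * size (nth [::] Ls i) + 13).+2).+1)))).
  rewrite def_w /= size_vertex_cells.
  have : \sum_(i < size Ls) (8 * size (nth [::] Ls i) + 13).+2 <=
     20 * \sum_(i < size Ls) (size (flatten (map entry_cells (nth [::] Ls i)))).+1.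
    rewrite big_distrr; apply: leq_sum => i _ /=.
    suff : size (nth [::] Ls i) <= size (flatten (map entry_cells (nth [::] Ls i))).
      lia.
    by elim: (nth _ _ _) => //= e l IH; rewrite size_cat; lia.
  (* Both sums are abstracted to variables, which leaves a linear inequality. *)
  by apply: (fun a b => _ : a <= 20 * b -> 4 + (4 + (2 + a.+1)) <= 20 * b.+3); lia.
pose Q1 m := [/\ [/\ m rans = 0, m rone = 1, m rbase = 20 & m rn = size Ls],
  m rv = 0 /\ m rcv = 0, m rk = 0 & forall u, m (20 + u) = 0].
apply: wp_seq.
apply: (@wp_conseq w _ 4 _ (fun m => Q1 m /\ (m rx = sg /\ m rT = 0))) => //.
  by apply: wp_block => //; rewrite /effect /= /upd /= def_w.
move=> m [Hm [mx mT]].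
apply: wp_seq.
apply: (@wp_conseq w _ 4 _ (fun m => Q1 m /\ m rT = threshold)) => //.
  apply: wp_if; rewrite mx /threshold; case: ifP => Hsg; first exact: wp_skip.
  apply: (@wp_block _ [:: _; _]) => //; rewrite /effect /= /upd /=.
  by case: Hm => -[? ? ? ?] [? ?] ? ?; split; rewrite ?def_w.
move=> {mx mT Hm} {}m [[[m0 m1 m19 mn] [mv mcv] mk mc] mT].
pose Inv i m :=
    [/\ [/\ m rans = 0, m rone = 1 & m rbase = 20],
        [/\ m rn = size Ls, m rT = threshold & m rk = \sum_(u < i) (deps u != 0)],
        drop (m rpos) w = flatten (map vertex_cells (drop i Ls)) /\
          (m rv = i /\ m rcv = size Ls - i),
        forall u, m (20 + u + u) = 0 &
        forall u, m (20 + u + u + 1) = if u < i then deps u else 0].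
apply/wp_seq/wp_block => //; rewrite /effect /= /upd /=.
apply: (@wp_for w (fun i => 8 * size (nth [::] Ls i) + 13) Inv).
- move=> m' [H1 H2 [H3 [_ H4]] H5 H6]; split; first by rewrite H4 subnn.
  (* Beyond the last vertex [nth] returns the empty list, whose count 0 agrees with the untouched
     cell. *)
  split=> // u; rewrite H6; case: ltnP => // leu.
  by rewrite /deps nth_default // /num_members big_nil.
- move=> i m' lti [[H0 H1 H19] [Hn HT Hk] [H3 [Hv Hcv]] H5 H6].
  split; first by rewrite Hcv; lia.
  move: H3; rewrite (drop_nth [::] lti) /= => /drop_cons[H3 H3'].
  apply: (@wp_le w _ (3 + ((8 * size (nth [::] Ls i)).+1 + (3 + 6)))); first lia.
  apply/wp_seq/wp_block => //; apply: wp_seq.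
  rewrite /effect /= /upd /= H1 H3.
  apply: wp_conseq (count_spec _ _ H3') (leqnn _) _ => //=.
  move=> m2 [E1 E2 E3].
  pose Q2 m3 := [/\ same_low [:: rcnt; rpos; rs; rdep; rk] m' m3,
    (m3 rdep = deps i /\ m3 rk = \sum_(u < i.+1) (deps u != 0)),
    drop (m3 rpos) w = flatten (map vertex_cells (drop i.+1 Ls)) &
    forall u, m3 (20 + u) = m' (20 + u)].
  have E4 : same [:: rcnt; rpos; rs; rdep] m' m2.
    by move=> j Hj; rewrite E1 //; move: j Hj;
      frame (@same_refl [:: rcnt; rpos; rs; rdep] m').
  apply: wp_seq; apply: (@wp_conseq w _ 3 _ Q2) => //.
    apply: wp_if; rewrite E3 -/(deps i); case: ifP => Hd.
      apply: (@wp_block _ [:: _]) => //; rewrite /effect /= /upd /=.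
      rewrite (E4 16) // (E4 1) // Hk H1; split => //=.
      + by move=> j _ Hj; rewrite ifN ?E4 //; move: Hj; rewrite !inE; lia.
      + by rewrite big_ord_recr /= Hd.
      + by move=> u; rewrite E4.
    apply: wp_skip; split => //.
    + by move=> j _ Hj; rewrite E4 //; move: Hj; rewrite !inE; lia.
    + by rewrite (E4 16) // Hk big_ord_recr /= Hd addn0.
    + by move=> u; rewrite E4.
  move=> m3 [F1 [F2 F3] F4 F5].
  apply: wp_block => //; rewrite /effect /= /upd /=.
  rewrite F2 !(F1 19) // H19 !(F1 6) // Hv !(F1 7) // Hcv !(F1 1) // H1.
  split => //=.
  + by rewrite !F1.
  + by rewrite (F1 2) // (F1 3).
  + by split => //; lia.
  + by move=> u; rewrite rank_dep_cell -addnA F5 addnA H5.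
  + move=> u; rewrite eq_dep_cell -!addnA F5 !addnA H6.
    by case: eqP => [->|/eqP ne]; [rewrite leqnn | congr (if _ then _ else _); lia].
- split => //=.
  + by rewrite mk big_ord0.
  + by rewrite def_w /= !drop0 mcv mn mv subn0.
  + by move=> u; rewrite -addnA mc.
  + by move=> u; rewrite -!addnA mc.
Qed.

End Setup.

Section Main.

Variables (w : seq nat) (Ls : seq (seq (seq nat * nat))) (sg t : nat).
Hypothesis def_w : w = [:: size Ls, sg, t & flatten (map vertex_cells Ls)].

Let bnd := bound (ndeps Ls) (deps Ls).
Let wt := weight (ndeps Ls) (deps Ls).
Let cd := code (ndeps Ls) (deps Ls).

Definition feasible : Prop := exists2 R : nat -> nat,
  forall u, R u <= bnd u & threshold sg t <= total R Ls.

Lemma bnd_default u : size Ls <= u -> bnd u = 0.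
Proof.
by move=> leu; rewrite /bnd /bound /deps nth_default // /num_members big_nil.
Qed.

(** The code fixes the digits below [size Ls], and the bounds force all later ones to be 0. *)
Lemma total_ext R R' : (forall u, R u <= bnd u) -> (forall u, R' u <= bnd u) ->
  cd R (size Ls) = cd R' (size Ls) -> total R Ls = total R' Ls.
Proof.
move=> Rb Rb' E.
have ER u : R u = R' u.
  have [ltu|leu] := ltnP u (size Ls); first exact: (code_inj Rb Rb' E).
  by have := Rb u; have := Rb' u; rewrite bnd_default //; lia.
apply: eq_bigr => v _; rewrite /best ER; apply: eq_bigl => e.
by apply: eq_all => u; rewrite ER.
Qed.

(** The factor 61 absorbs 20 for the setup, 13 for a scan, 21 for an odometer step and the constant
    overheads, using [size Ls + 3 <= size w]. *)
Lemma bnsl_prog_spec :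
  wp w bnsl_prog (61 * size w * wt (size Ls))
    (fun m => exists2 b : bool, m rans = b & b <-> feasible) (fun=> 0).
Proof.
set N := wt (size Ls).
have N0 : 0 < N by rewrite /N /wt /weight prodn_gt0.
have w2 : 2 < size w by rewrite def_w.
have wn : size Ls + 3 <= size w.
  rewrite def_w /= size_vertex_cells addn3 !ltnS.
  rewrite -[X in X <= _]card_ord -sum1_card; apply: leq_sum => i _; lia.
apply: (@wp_le w _ (20 * size w + (1 + (\sum_(i < N)
  (13 * size w + (1 + (3 + (21 * size Ls + 5)))).+2).+1))).
  rewrite sum_nat_const card_ord; nia.
apply: wp_seq; apply: wp_conseq (setup_spec def_w) (leqnn _) _.
move=> m [[m0 m1 m19] [mn mT mk] mR mD].
apply/wp_seq/wp_block => //; rewrite /effect /= /upd /=.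
(* Round [i] tests the rank function with code [i]; [rans] tells whether one with a smaller code has
   reached the threshold. *)
pose Inv i m := exists R,
  [/\ (forall u, R u <= bnd u) /\ (forall u, m (20 + u + u) = R u),
      forall u, m (20 + u + u + 1) = deps Ls u,
      [/\ m rone = 1, m rbase = 20, m rn = size Ls, m rT = threshold sg t &
          m rk = ndeps Ls],
      m rgo = (i < N) /\ (i < N -> cd R (size Ls) = i) &
      exists2 b : bool, m rans = b & b <-> exists R',
        [/\ forall u, R' u <= bnd u, cd R' (size Ls) < i &
            threshold sg t <= total R' Ls]].
apply: (@wp_for w (fun=> 13 * size w + (1 + (3 + (21 * size Ls + 5)))) Inv).
- move=> m' [R [_ _ _ [H4 _] [b H5 H6]]]; split; first by rewrite H4 ltnn.
  (* All bounded rank functions have codes below [N], so after round [N - 1] none is left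
     untested. *)
  exists b => //; rewrite H6; split=> [[R' [? ? ?]]|[R' ? ?]]; exists R' => //.
  by split=> //; exact: code_lt.
- move=> i m' ltiN [R [[Rb HR] HD [H1 H19 Hn HT Hk] [Hgo /(_ ltiN) Hc] [b Hb Hb']]].
  split; first by rewrite Hgo ltiN.
  apply: wp_seq; apply: wp_conseq (scan_spec H1 H19 HR Hn w2 _) (leqnn _) _.
    by rewrite def_w /= drop0.
  move=> m2 [E1 E2].
  pose Q3 m3 := same [:: rans, rx, rv, rcv, rrank, rtot & scan_regs] m' m3 /\
    m3 rans = (b || (threshold sg t <= total R Ls)).
  apply/wp_seq/wp_block => //; rewrite /effect /= /upd /=.
  apply: wp_seq; apply: (@wp_conseq w _ 3 _ Q3) => //.
    apply: wp_if => /=; rewrite (E1 3) // HT E2 subn_eq0 /Q3.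
    case: leqP => /= Hle.
      apply: (@wp_block _ [:: _]) => //; rewrite /effect /= /upd /=.
      rewrite orbT; split => //= j Hj.
      by rewrite !ifN ?E1 //; move: Hj; rewrite !inE; lia.
    apply: wp_skip; rewrite orbF /= E1 //; split => // j Hj.
    by rewrite ifN ?E1 //; move: Hj; rewrite !inE; lia.
  move=> m3 [F1 F2].
  apply: wp_conseq
    (odometer_spec (k := ndeps Ls) (D := deps Ls) (R := R) _ _ _ _ _ _ _ _)
    (leqnn _) _.
  + by rewrite F1.
  + by rewrite F1.
  + by rewrite F1.
  + by rewrite F1 // Hk.
  + by move=> u; rewrite F1.
  + by move=> u; rewrite F1.
  + exact: Rb.
  move=> m4 [R' [G1 G2 G3 G4 [G5 G6]]].
  (* Together with [G7] this shows that the carry leaves the counter exactly when [i.+1 = N]. *)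
  have {}G6 : cd R' (size Ls) + (m4 rgo == 0) * N = i.+1 by rewrite -Hc.
  have G7 : cd R' (size Ls) < N by exact: code_lt.
  exists R'; split => //.
  + by rewrite !G4 // !F1.
  + by split; move: G5 G6; case: (m4 rgo) => [|[|]] //= _; lia.
  + exists (b || (threshold sg t <= total R Ls)); first by rewrite G4.
    split.
      case/orP => [/Hb'[R1 [? ? ?]]|?]; first by exists R1; split=> //; lia.
      by exists R; split => //; lia.
    (* A function with code [i] has the same total as the one just tested. *)
    case=> R1 [R1b]; rewrite ltnS leq_eqVlt => /orP[/eqP E|lt] Hle.
      by rewrite (total_ext Rb R1b) ?Hle ?orbT // E.
    by apply/orP; left; apply/Hb'; exists R1.
- exists (fun=> 0); split => //=.
  + by rewrite N0; split=> // _; apply: big1.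
  + by exists false => //; split=> // -[R' [_]].
Qed.

End Main.

(** * Computability of the parameter bound *)

Lemma computable_exp2_sq C : computable (fun k => C * 2 ^ (k * k)).
Proof.
(* Register 0 starts at [C] and is doubled in [k] rounds of [k] additions. *)
pose inner := While 3 (Block [:: Add 0 0 0; Sub 3 3 1]).
pose outer := While 2 (Seq (Block [:: Const 3 0; Add 3 3 4])
  (Seq inner (Block [:: Sub 2 2 1]))).
(* Register 5 still holds 0, so both reads fetch the input [k]. *)
pose p := Seq (Block [:: Const 1 1; Read 4 5; Read 2 5; Const 0 C]) outer.
exists (compile 0 p) => k.
exists (4 + (\sum_(i < k) (2 + ((\sum_(j < k) 4).+1 + 1)).+2).+1).
have [|y ->//] := @wp_outputs [:: k] p
  (4 + (\sum_(i < k) (2 + ((\sum_(j < k) 4).+1 + 1)).+2).+1)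
  (fun y => y = C * 2 ^ (k * k)).
apply/wp_seq/wp_block => //; rewrite /effect /= /upd /=.
pose I1 i (m : memory) := [/\ m 1 = 1, m 4 = k, m 2 = k - i & m 0 = C * 2 ^ (i * k)].
apply: (@wp_for _ (fun=> 2 + ((\sum_(j < k) 4).+1 + 1)) I1).
- by move=> m [_ _ -> ->]; rewrite subnn.
- move=> i m lti [m1 m4 m2 m0]; split; first lia.
  apply/wp_seq/wp_block => //; rewrite /effect /= /upd /=; apply: wp_seq.
  pose I2 j (m' : memory) := [/\ m' 1 = 1, m' 4 = k, m' 2 = k - i, m' 3 = k - j &
     m' 0 = C * 2 ^ (i * k + j)].
  apply: (@wp_for _ (fun=> 2) I2).
  + move=> m' [n1 n4 n2 n3 n0]; split; first by rewrite n3 subnn.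
    apply: wp_block => //; rewrite /effect /= /upd /=.
    by split => //=; [rewrite n2 n1; lia | rewrite n0 mulSn addnC].
  + move=> j m' ltj [n1 n4 n2 n3 n0]; split; first lia.
    apply: wp_block => //; rewrite /effect /= /upd /=.
    split => //=; first by rewrite n3 n1; lia.
    by rewrite n0 addnS expnS; lia.
  + by split => //=; rewrite ?m4 ?subn0 ?addn0.
- by split => //=; rewrite ?subn0 // muln1.
Qed.

(** * Rank functions and acyclic digraphs *)

(** A path from [v] back to [u], once shortened to be free of repetitions, would close up with the
    arc [(u, v)] to a directed cycle. *)
Lemma acyclic_irr_connect n (A : {set 'I_n * 'I_n}) u v : acyclic A ->
  (u, v) \in A -> connect (fun x y => (x, y) \in A) v u = false.
Proof.
move=> acA uvA; apply/negP => /connectP [p0 /shortenP[p pp up _] Eu].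
have : ucycle (fun x y => (x, y) \in A) (v :: p).
  by rewrite /ucycle /cycle rcons_path pp -Eu uvA.
by move/acA.
Qed.

(** Along a directed cycle the rank would increase strictly and yet return to its start. *)
Lemma rank_acyclic n (A : {set 'I_n * 'I_n}) (R : 'I_n -> nat) :
  (forall u v, (u, v) \in A -> R u < R v) -> acyclic A.
Proof.
move=> HR [//|x p] /andP[/=]; rewrite rcons_path => /andP[pp e] _.
suff : R x <= R (last x p) by have := HR _ _ e; lia.
elim: p x {e} pp => //= y p IH x /andP[/HR xy /IH]; lia.
Qed.

(** * Presentations of an instance and feasibility *)

Section Instance.

Variables (I : bnsl) (G : 'I_(nV I) -> seq (seq 'I_(nV I) * nat)).
Hypothesis listG : forall v, lists_nonzero v (G v).

Local Notation n := (nV I).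

Definition raw (v : 'I_n) : seq (seq nat * nat) :=
  [seq (map val e.1, e.2) | e <- G v].

Definition raws : seq (seq (seq nat * nat)) := map raw (enum 'I_n).

Lemma size_raws : size raws = n.
Proof. by rewrite size_map size_enum_ord. Qed.

Lemma nth_raws (v : 'I_n) : nth [::] raws v = raw v.
Proof. by rewrite (nth_map v) ?size_enum_ord // nth_ord_enum. Qed.

Lemma vertex_word_raw v : vertex_word (G v) = vertex_cells (raw v).
Proof.
rewrite /vertex_word /vertex_cells /raw size_map -map_comp.
congr (_ :: flatten _); apply: eq_map => e.
by rewrite /entry_word /entry_cells /= size_map.
Qed.

Lemma entry_score v e : e \in G v -> score_fun v [set u in e.1] = e.2.
Proof.
have [_ /perm_mem H] := listG v.
move=> /(map_f (fun e : seq 'I_n * nat => ([set u in e.1], e.2))).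
by rewrite H => /imageP[Z _ [-> ->]].
Qed.

Lemma nonzero_entry v (Z : {set 'I_n}) : score_fun v Z != 0 ->
  exists2 e, e \in G v & [set u in e.1] = Z /\ e.2 = score_fun v Z.
Proof.
have [_ /perm_mem H] := listG v => nz.
have : (Z, score_fun v Z) \in [seq (Z, score_fun v Z) | Z in nonzero_sets v].
  by apply/imageP; exists Z => //; rewrite inE.
by rewrite -H => /mapP[e eG [-> ->]]; exists e.
Qed.

(** The entries are a permutation of the nonzero sets, and a set listed without repetition has as
    many members as its list. *)
Lemma sum_entries v (F : nat -> nat) :
  \sum_(e <- G v) F (size e.1) = \sum_(Z in nonzero_sets v) F #|Z|.
Proof.
have [/allP uG H] := listG v.
have := perm_big (op := addn) (x := 0) (P := xpredT)
  (F := fun x : {set 'I_n} * nat => F #|x.1|) _ H.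
rewrite big_map big_image /= => <-.
apply: eq_big_seq => e /uG ue; rewrite cardsE; congr F.
by rewrite (card_uniqP ue).
Qed.

Lemma deps_raws (v : 'I_n) :
  deps raws v = \sum_(Z in nonzero_sets v) #|Z|.
Proof.
rewrite /deps nth_raws /num_members /raw big_map -(sum_entries v id).
by apply: eq_bigr => e _; rewrite size_map.
Qed.

Lemma deps_dependent (v : 'I_n) : (deps raws v != 0) = dependent v.
Proof.
rewrite deps_raws sum_nat_eq0 /dependent; congr (~~ _).
apply/forall_inP/eqP => [H|H Z ZG].
  by apply: big1 => Z /H; rewrite cards_eq0 => /eqP.
by rewrite cards_eq0 -subset0 -H; exact: (bigcup_sup Z).
Qed.

Lemma ndeps_raws : ndeps raws = num_dependent I.
Proof.
rewrite /ndeps size_raws /num_dependent -sum1_card [RHS]big_mkcond /=.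
by apply: eq_bigr => v _; rewrite inE deps_dependent; case: dependent.
Qed.

(** A dependent vertex contributes its radix, the number of dependent vertices plus one; an
    independent vertex contributes 1. *)
Lemma weight_raws : weight (ndeps raws) (deps raws) (size raws) =
  (num_dependent I).+1 ^ num_dependent I.
Proof.
rewrite /weight size_raws {2}/num_dependent -prod_nat_const [RHS]big_mkcond /=.
apply: eq_bigr => v _.
by rewrite inE /bound deps_dependent ndeps_raws; case: dependent.
Qed.

(** An entry for [Z] takes [#|Z| + 2] cells, at most [3 * #|Z|] unless [Z] is empty. The empty set
    occurs at most once per vertex, so with the count cell each vertex adds only 3 more. *)
Lemma size_word w :
  w = [:: n; nat_of_bool (target I < 0)%R; `|target I|%N]
        ++ flatten [seq vertex_word (G v) | v <- enum 'I_n] ->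
  size w <= 3 * (nonzero_size I).+1.
Proof.
move=> ->; rewrite size_cat /= size_flatten /shape -map_comp sumnE big_map big_enum /=.
apply: (@leq_trans (3 + \sum_(v < n) (3 + 3 * \sum_(Z in nonzero_sets v) #|Z|))).
  rewrite !addSn !ltnS; apply: leq_sum => v _.
  rewrite /= size_flatten /shape -map_comp sumnE big_map.
  rewrite (eq_bigr (fun e => (size e.1).+2)); last first.
    by move=> e _; rewrite /= size_map.
  rewrite (sum_entries v (fun x => x.+2)).
  apply: (@leq_trans (1 + \sum_(Z in nonzero_sets v) (3 * #|Z| + 2 * (Z == set0)))).
    by rewrite add1n ltnS; apply: leq_sum => Z _; rewrite -cards_eq0; lia.
  rewrite big_split /= -!big_distrr /=.
  suff : \sum_(Z in nonzero_sets v) (Z == set0) <= 1.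
    set a := \sum_(Z in nonzero_sets v) (Z == set0).
    set b := \sum_(Z in nonzero_sets v) #|Z|; lia.
  rewrite -big_mkcondr /= sum1_card -(cards1 (set0 : {set 'I_n})).
  by apply/subset_leq_card/subsetP => Z; rewrite !inE => /andP[].
rewrite big_split /= sum_nat_const card_ord -big_distrr /= /nonzero_size.
set b := \sum_(v < n) _; lia.
Qed.

Lemma feasible_yes :
  feasible raws (nat_of_bool (target I < 0)%R) `|target I|%N <-> bnsl_yes I.
Proof.
have Hth s : (threshold (nat_of_bool (target I < 0)%R) `|target I| <= s)
    = (target I <= s%:Z)%R.
  by rewrite /threshold; case: (target I).
have Htot R : total R raws = \sum_(v < n) best R (R v) (raw v).
  by rewrite /total size_raws; apply: eq_bigr => v _; rewrite nth_raws.
have Hbest R (v : 'I_n) : best R (R v) (raw v) =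
    \max_(e <- G v | all (fun u : 'I_n => R u < R v) e.1) e.2.
  by rewrite /best /raw big_map; apply: eq_bigl => e; rewrite all_map.
split.
- case=> R _; rewrite Hth Htot => HT.
  have Hex (v : 'I_n) : exists Z : {set 'I_n},
      [forall u in Z, R u < R v] && (best R (R v) (raw v) <= score_fun v Z).
    (* If the best value is 0, the empty parent set already attains it. *)
    have [E0|nz] := eqVneq (best R (R v) (raw v)) 0.
      by exists set0; rewrite E0 andbT; apply/forall_inP => u; rewrite inE.
    suff [e eG [ok Ee]] : exists2 e, e \in G v &
        all (fun u : 'I_n => R u < R v) e.1 /\ best R (R v) (raw v) = e.2.
      exists [set u in e.1]; rewrite entry_score // Ee leqnn andbT.
      by apply/forall_inP => u; rewrite inE => ue; exact: (allP ok).
    (* A nonzero maximum is attained by a listed entry. *)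
    move: nz; rewrite Hbest big_seq_cond.
    elim/big_ind: _ => // [x y Hx Hy|e /andP[eG ok] _]; last by exists e.
    by case: (leqP x y).
  pose Z v := xchoose (Hex v).
  have HZ v : (forall u, u \in Z v -> R u < R v) /\
      best R (R v) (raw v) <= score_fun v (Z v).
    by have /andP[/forall_inP] := xchooseP (Hex v).
  pose A : {set 'I_n * 'I_n} := [set x | x.1 \in Z x.2].
  have PA v : parents A v = Z v by apply/setP => u; rewrite !inE.
  exists A.
    by apply: (@rank_acyclic _ _ R) => u v; rewrite inE => /(proj1 (HZ v)).
  apply: Order.POrderTheory.le_trans HT _.
  rewrite lez_nat; apply: leq_sum => v _; rewrite PA; exact: (proj2 (HZ v)).
- case=> A acA HA.
  pose e := [rel x y | (x, y) \in A].
  (* Dependent ancestors, reached through any vertices; a dependent [v] counts as its own ancestor,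
     so its rank is positive. *)
  pose anc (v : 'I_n) := [set u | dependent u & connect e u v].
  pose r (v : 'I_n) := if dependent v then #|anc v| else 0.
  pose R (u : nat) := if insub u is Some v then r v else 0.
  have RE (v : 'I_n) : R v = r v by rewrite /R valK.
  exists R.
    move=> u; rewrite /R; case: insubP => // v _ <-.
    rewrite /r /bound deps_dependent ndeps_raws; case: ifP => // dv.
    by apply/subset_leq_card/subsetP => x; rewrite !inE => /andP[].
  rewrite Hth Htot; apply: Order.POrderTheory.le_trans HA _.
  rewrite lez_nat; apply: leq_sum => v _.
  have [->//|nz] := eqVneq (score_fun v (parents A v)) 0.
  have [x xG [Ex1 Ex2]] := nonzero_entry nz.
  rewrite -Ex2 Hbest.
  suff ok : all (fun u : 'I_n => R u < R v) x.1.
    by rewrite (big_rem x) //= ok leq_maxl.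
  apply/allP => u ux.
  have uP : u \in parents A v by rewrite -Ex1 inE.
  have uvA : (u, v) \in A by move: uP; rewrite inE.
  have dv : dependent v.
    apply/set0Pn; exists u; apply/bigcupP; exists (parents A v) => //.
    by rewrite inE.
  have vanc : v \in anc v by rewrite inE dv connect0.
  (* An independent parent has rank 0, below the positive rank of [v]. For a dependent parent, its
     ancestors are ancestors of [v], and by acyclicity [v] is not among them. *)
  rewrite !RE /r dv; case: ifP => du; last by apply/card_gt0P; exists v.
  apply: proper_card; apply/properP; split.
    apply/subsetP => y; rewrite !inE => /andP[-> /= yu].
    by apply: connect_trans yu _; apply: connect1.
  by exists v => //; rewrite inE dv /= (acyclic_irr_connect acA uvA).
Qed.

End Instance.

Theorem theorem13 : fpt (bnsl_nonzero_by num_dependent).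
Proof.
(* 183 is 61 times the factor 3 of [size_word]. The power [2 ^ (k * k)] dominates [(k + 1) ^ k] and
   is easy to compute by doubling; the time is linear in the size. *)
exists (compile 0 bnsl_prog), (fun k => 183 * 2 ^ (k * k)), 1.
split; first exact: computable_exp2_sq.
move=> I w [G listG Ew].
have def_w : w = [:: size (raws G), nat_of_bool (target I < 0)%R, `|target I|%N
                  & flatten (map vertex_cells (raws G))].
  rewrite Ew size_raws /= /raws -map_comp; do 3 congr (_ :: _).
  by congr flatten; apply: eq_map => v; rewrite vertex_word_raw.
have := bnsl_prog_spec def_w; rewrite weight_raws // => Hwp.
have Hle : 61 * size w * (num_dependent I).+1 ^ num_dependent I <=
    183 * 2 ^ (num_dependent I * num_dependent I) * (nonzero_size I).+1 ^ 1.
  have Hw := size_word listG Ew.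
  have Hk : (num_dependent I).+1 ^ num_dependent I <=
            2 ^ (num_dependent I * num_dependent I).
    (* Both sides are 1 at 0; otherwise [k + 1 <= 2 ^ k] is raised to the power [k]. *)
    have [->//|k0] := posnP (num_dependent I).
    by rewrite expnM leq_exp2r // ltn_expl.
  by rewrite expn1 [leqRHS]mulnAC leq_mul //; lia.
have [y [b -> Hb] Hout] := wp_outputs (Q := fun y => exists2 b : bool, y = b &
  b <-> feasible (raws G) (nat_of_bool (target I < 0)%R) `|target I|%N)
  (wp_le Hle Hwp).
by exists b => //; rewrite Hb; exact: feasible_yes.
Qed.
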